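(* Let $\mathcal{T}$ be a probability tree with inner vertices $v_1,\dots,v_k$ and parameters $\theta\in\Theta_{\mathcal T}$, and put $d=\sum_{i=1}^k(\kappa_i-1)$. Then $\mathcal{T}$ represents a regular exponential family $$p_\theta(x)=h(x)\exp\Bigl(\sum_{i=1}^k\sum_{j=1}^{\kappa_i-1}\eta_{ij}(\theta)\,T_{ij}(x)-\psi(\theta)\Bigr),\qquad h\equiv 1,$$ for all root-to-leaf paths $x$, with the following attributes: 1. the indicators $T_{ij}=\alpha_{ij}$ of the first $j=1,\dots,\kappa_i-1$ edges of all inner vertices $i=1,\dots,k$ are a sufficient statistic; 2. the natural parameters are $\eta_{ij}(\theta)=\log\bigl(\theta_{ij}\,N_{ij}(\theta)/N_i(\theta)\bigr)$ for $j=1,\dots,\kappa_i-1$ and $i=1,\dots,k$, and the natural parameter space is $\mathbb{R}^d$; 3. the cumulant-generating function is $\psi(\theta)=-\log(N_1(\theta))$.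
   Context: **Probability trees.** Let $\mathcal{T}$ be a finite directed rooted tree in which every vertex has either no or at least two emanating edges. The inner (non-leaf) vertices are $v_1,\dots,v_k$ ($k\ge 1$), with $v_1$ the root. The edges emanating from $v_i$ are indexed by $j=1,\dots,\kappa_i$. Each edge has a label $\theta_{ij}\in(0,1)$ with $\sum_{j=1}^{\kappa_i}\theta_{ij}=1$ for every $i$. A tree labelled in this way is a probability tree. Its parameter space is $\Theta_{\mathcal T}=\prod_{i=1}^k\Delta^\circ_{\kappa_i-1}$, where $\Delta^\circ_{m-1}=\{t\in\mathbb{R}^m\mid \sum_r t_r=1,\ 0<t_r<1\text{ for all }r\}$. For a root-to-leaf path $x$, put $p_\theta(x)=\prod_{i=1}^k\prod_{j=1}^{\kappa_i}\theta_{ij}^{\alpha_{ij}(x)}$, where $\alpha_{ij}(x)=1$ if $x$ passes through the $j$th edge emanating from $v_i$ and $\alpha_{ij}(x)=0$ otherwise. The model represented by $\mathcal T$ is $\{p_\theta\mid\theta\in\Theta_{\mathcal T}\}$, a set of probability distributions on the set of root-to-leaf paths. **Downward edges and the functions $N_i$.** The last ($\kappa_i$th) edge emanating from $v_i$ is said to point downwards. Let $v_{ij}$ denote the vertex to which the $j$th edge coming out of $v_i$ leads. For every vertex $v$ define a function on $\Theta_{\mathcal T}$ recursively: it is the constant $1$ if $v$ is a leaf, and for an inner vertex $v_i$ it is $N_i(\theta)=\bigl(1-\sum_{s=1}^{\kappa_i-1}\theta_{is}\bigr)N_{i\kappa_i}(\theta)$, where $N_{ij}$ denotes the function attached to the vertex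 $v_{ij}$. Thus $N_i$ (resp. $N_{ij}$) is the product of the labels along the path from $v_i$ (resp. $v_{ij}$) to a leaf all of whose edges point downwards. **Exponential families.** A parametric model $\{p_\theta\mid\theta\in\Theta\}$ on a space $\mathcal X$ is an exponential family if every distribution in it can be written as $p_\theta(x)=h(x)\exp(\eta(\theta)^\top T(x)-\psi(\theta))$ for all $x\in\mathcal X$, where $\eta:\Theta\to\mathbb{R}^d$ is the canonical (natural) parameter, $T:\mathcal X\to\mathbb{R}^d$ is a minimally sufficient statistic and $\psi:\Theta\to\mathbb{R}$ is the cumulant-generating function. The natural parameter space is the set of those $\eta(\theta)\in\mathbb{R}^d$ for which the expression above is integrable. The family is a regular exponential family of dimension $d$ if its natural parameter space is a non-empty open subset of $\mathbb{R}^d$. *)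

(* Defs.v *)
From HB Require Import structures.
From mathcomp Require Import all_boot all_order all_algebra.
From mathcomp Require Import all_classical all_reals all_analysis.

Set Implicit Arguments.
Unset Strict Implicit.
Unset Printing Implicit Defensive.

Import Order.TTheory GRing.Theory Num.Theory.
Import numFieldNormedType.Exports.

Local Open Scope classical_set_scope.
Local Open Scope ring_scope.

(* The vertices with emanating edges are exactly the [inner i]; the [j]-th edge
   out of [inner i] leads to [child i j].  Indices start at 0, so the root v_1
   is [inner] of the first index. *)
Record out_graph := OutGraph {
  n_inner : nat;
  n_inner_gt0 : (0 < n_inner)%N;
  kappa : 'I_n_inner -> nat;
  vertex : finType;
  inner : 'I_n_inner -> vertex;
  child : forall i : 'I_n_inner, 'I_(kappa i) -> vertex
}.
Arguments child {o} i j.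

Definition root_index (G : out_graph) : 'I_(n_inner G) := Ordinal (n_inner_gt0 G).
Definition root_vertex (G : out_graph) : vertex G := inner (root_index G).

Definition edge (G : out_graph) : finType := {i : 'I_(n_inner G) & 'I_(kappa i)}.
Definition mk_edge (G : out_graph) (i : 'I_(n_inner G)) (j : 'I_(kappa i)) : edge G :=
  Tagged (fun i : 'I_(n_inner G) => 'I_(kappa i)) j.
Definition src (G : out_graph) (e : edge G) : vertex G := inner (tag e).
Definition tgt (G : out_graph) (e : edge G) : vertex G := child (tag e) (tagged e).

Definition is_leaf (G : out_graph) (v : vertex G) : bool :=
  [forall i, inner i != v].

Fixpoint is_walk (G : out_graph) (v : vertex G) (s : seq (edge G))
    (w : vertex G) : bool :=
  if s is e :: s' then (src e == v) && is_walk (tgt e) s' w else v == w.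

(* [unique_walk] is the usual definition of a directed rooted tree
   (arborescence): from the root there is exactly one directed walk to each
   vertex. *)
Record tree := Tree {
  graph :> out_graph;
  inner_inj : injective (@inner graph);
  kappa_gt1 : forall i : 'I_(n_inner graph), (1 < kappa i)%N;
  unique_walk : forall v : vertex graph,
    exists! s : seq (edge graph), is_walk (root_vertex graph) s v
}.

Lemma kappa_pred_lt (T : tree) (i : 'I_(n_inner T)) : ((kappa i).-1 < kappa i)%N.
Proof. by rewrite ltn_predL (ltn_trans _ (kappa_gt1 i)). Qed.

Definition last_edge (T : tree) (i : 'I_(n_inner T)) : 'I_(kappa i) :=
  Ordinal (kappa_pred_lt i).
Definition upper_edge (T : tree) (i : 'I_(n_inner T)) (j : 'I_(kappa i).-1) :
  'I_(kappa i) := widen_ord (leq_pred (kappa i)) j.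

Lemma walk_exists (T : tree) (v : vertex T) :
  exists s : seq (edge T), is_walk (root_vertex T) s v.
Proof. by have [s [Hs _]] := unique_walk v; exists s. Qed.

Definition walk_to (T : tree) (v : vertex T) : seq (edge T) :=
  xchoose (walk_exists v).

Lemma walk_toP (T : tree) (v : vertex T) : is_walk (root_vertex T) (walk_to v) v.
Proof. exact: (xchooseP (walk_exists v)). Qed.

Lemma walk_to_uniq (T : tree) (v : vertex T) (s : seq (edge T)) :
  is_walk (root_vertex T) s v -> walk_to v = s.
Proof.
have [t [_ tP]] := unique_walk v => Hs.
by rewrite -(tP _ (walk_toP v)) -(tP _ Hs).
Qed.

Definition is_root_leaf (T : tree) (s : seq (edge T)) : bool :=
  [exists v, is_leaf v && is_walk (root_vertex T) s v].

Record path_of (T : tree) := PathOf {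
  path_edges :> seq (edge T);
  path_ofP : is_root_leaf path_edges
}.
HB.instance Definition _ (T : tree) := [isSub for @path_edges T].
HB.instance Definition _ (T : tree) := [Countable of path_of T by <:].

Definition path_leaf (T : tree) (x : path_of T) : vertex T :=
  xchoose (existsP (path_ofP x)).
Definition leaf_path (T : tree) (v : vertex T) : option (path_of T) :=
  insub (walk_to v).

Lemma path_leafK (T : tree) : pcancel (@path_leaf T) (@leaf_path T).
Proof.
move=> x; rewrite /leaf_path /path_leaf.
have /andP[_ /walk_to_uniq ->] := xchooseP (existsP (path_ofP x)).
exact: valK.
Qed.

HB.instance Definition _ (T : tree) :=
  fintype.isFinite.Build (path_of T) (pcan_enumP (@path_leafK T)).

Definition open_simplex (R : realType) (m : nat) : set 'rV[R]_m :=
  [set t | \sum_r t 0 r = 1 /\ forall r, 0 < t 0 r < 1].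

Definition param (R : realType) (T : tree) : Type :=
  forall i : 'I_(n_inner T), 'rV[R]_(kappa i).

Definition param_space (R : realType) (T : tree) : set (param R T) :=
  [set theta | forall i, open_simplex (theta i)].
Arguments param_space R T : clear implicits.

Definition alpha (T : tree) (i : 'I_(n_inner T)) (j : 'I_(kappa i))
    (x : path_of T) : nat := mk_edge j \in path_edges x.

Definition path_prob (R : realType) (T : tree) (theta : param R T)
    (x : path_of T) : R :=
  \prod_(i < n_inner T) \prod_(j < kappa i) theta i 0 j ^+ alpha j x.

Definition downN_step (R : realType) (T : tree) (theta : param R T)
    (f : vertex T -> R) (v : vertex T) : R :=
  if [pick i | inner i == v] is Some i then
    (1 - \sum_(s < (kappa i).-1) theta i 0 (upper_edge s))
      * f (child i (last_edge i))
  else 1.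

Definition tree_height (T : tree) : nat := \max_(v : vertex T) size (walk_to v).

(* The functions N_i and N_ij: the unique solution of the recursion, see
   [downN_leaf] and [downN_inner];
   iterating once per level of the tree is enough to reach it. *)
Definition downN (R : realType) (T : tree) (theta : param R T) : vertex T -> R :=
  iter (tree_height T) (downN_step theta) (fun=> 1).

Lemma walk_rcons (G : out_graph) (e : edge G) (s : seq (edge G))
    (v : vertex G) : is_walk v s (src e) -> is_walk v (rcons s e) (tgt e).
Proof.
elim: s v => [|f s IH] v /=; first by move/eqP->; rewrite !eqxx.
by case/andP=> -> /IH.
Qed.

Lemma size_walk_child (T : tree) (i : 'I_(n_inner T)) (j : 'I_(kappa i)) :
  size (walk_to (child i j)) = (size (walk_to (inner i))).+1.
Proof.
have /walk_to_uniq /= -> : is_walk (root_vertex T)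
    (rcons (walk_to (inner i)) (mk_edge j)) (child i j).
  exact: (@walk_rcons T (mk_edge j) _ _ (walk_toP _)).
by rewrite size_rcons.
Qed.

Lemma size_walk_tree_height (T : tree) (v : vertex T) :
  (size (walk_to v) <= tree_height T)%N.
Proof. exact: (leq_bigmax (F := fun v => size (walk_to v))). Qed.

Lemma eq_downN_step (R : realType) (T : tree) (theta : param R T)
    (f g : vertex T -> R) (v : vertex T) :
  (forall i, inner i = v ->
     f (child i (last_edge i)) = g (child i (last_edge i))) ->
  downN_step theta f v = downN_step theta g v.
Proof.
by move=> fg; rewrite /downN_step; case: pickP => [i /eqP /fg ->|].
Qed.

Lemma downN_step_iter (R : realType) (T : tree) (theta : param R T) n v :
  (tree_height T <= size (walk_to v) + n)%N ->
  iter n.+1 (downN_step theta) (fun=> 1) v = iter n (downN_step theta) (fun=> 1) v.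
Proof.
elim: n v => [|n IH] v hn.
  rewrite [LHS]/= /downN_step; case: pickP => [i /eqP iv|//].
  have := size_walk_tree_height (child i (last_edge i)).
  by rewrite size_walk_child iv => /leq_trans/(_ hn); rewrite addn0 ltnn.
apply: (@eq_downN_step _ _ theta (iter n.+1 _ _) (iter n _ _)) => i iv.
by apply: IH; rewrite size_walk_child iv addSnnS.
Qed.

Lemma downN_fix (R : realType) (T : tree) (theta : param R T) (v : vertex T) :
  downN theta v = downN_step theta (downN theta) v.
Proof. exact/esym/downN_step_iter/leq_addl. Qed.

Lemma downN_leaf (R : realType) (T : tree) (theta : param R T) (v : vertex T) :
  is_leaf v -> downN theta v = 1.
Proof.
move/forallP=> lv; rewrite downN_fix /downN_step.
by case: pickP => // i iv; have := lv i; rewrite iv.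
Qed.

Lemma downN_inner (R : realType) (T : tree) (theta : param R T) (i : 'I_(n_inner T)) :
  downN theta (inner i) =
    (1 - \sum_(s < (kappa i).-1) theta i 0 (upper_edge s))
      * downN theta (child i (last_edge i)).
Proof.
rewrite downN_fix /downN_step; case: pickP => [i' /eqP /inner_inj -> //|].
by move/(_ i); rewrite eqxx.
Qed.

Section Models.
Context {R : realType} {X : finType} {P : Type}.

Definition is_distribution (p : X -> R) : Prop :=
  (forall x, 0 <= p x) /\ \sum_x p x = 1.

Definition stat_prob (Y : eqType) (p : X -> R) (S : X -> Y) (y : Y) : R :=
  \sum_(x | S x == y) p x.

(* The conditional probability of [x] given [S = y]; meaningful only when
   [0 < stat_prob p S y]. *)
Definition cond_prob (Y : eqType) (p : X -> R) (S : X -> Y) (x : X) (y : Y) : R :=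
  (if S x == y then p x else 0) / stat_prob p S y.

Definition sufficient (Theta : set P) (p : P -> X -> R) (Y : eqType)
    (S : X -> Y) : Prop :=
  forall t t', Theta t -> Theta t' -> forall y : Y,
    0 < stat_prob (p t) S y -> 0 < stat_prob (p t') S y ->
    forall x, cond_prob (p t) S x y = cond_prob (p t') S x y.

(* A sufficient statistic is minimal if it is, almost surely for every member
   of the model, a function of any other sufficient statistic. *)
Definition minimal_sufficient (Theta : set P) (p : P -> X -> R) (Y : eqType)
    (S : X -> Y) : Prop :=
  sufficient Theta p S /\
  forall (Z : eqType) (S' : X -> Z), sufficient Theta p S' ->
    exists f : Z -> Y, forall t, Theta t -> forall x, 0 < p t x -> S x = f (S' x).

Definition dot (d : nat) (u v : 'rV[R]_d) : R := (u *m v^T) 0 0.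

Definition exp_density (d : nat) (h : X -> R) (eta : P -> 'rV[R]_d)
    (T : X -> 'rV[R]_d) (psi : P -> R) (t : P) (x : X) : R :=
  h x * expR (dot (eta t) (T x) - psi t).

Definition exponential_family (Theta : set P) (p : P -> X -> R) (d : nat)
    (h : X -> R) (eta : P -> 'rV[R]_d) (T : X -> 'rV[R]_d) (psi : P -> R) : Prop :=
  [/\ forall t, Theta t -> is_distribution (p t),
      forall t, Theta t -> forall x, p t x = exp_density h eta T psi t x
    & minimal_sufficient Theta p T].

(* Only the vectors attained by [eta] on [Theta] are considered; integrability
   is with respect to the counting measure. *)
Definition natural_parameter_space (Theta : set P) (d : nat)
    (h : X -> R) (eta : P -> 'rV[R]_d) (T : X -> 'rV[R]_d) (psi : P -> R) :
    set 'rV[R]_d :=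
  [set eta t | t in [set t | Theta t /\
     summable [set: X] (fun x => (exp_density h eta T psi t x)%:E)]].

Definition regular_exponential_family (Theta : set P) (p : P -> X -> R)
    (d : nat) (h : X -> R) (eta : P -> 'rV[R]_d) (T : X -> 'rV[R]_d)
    (psi : P -> R) : Prop :=
  [/\ exponential_family Theta p h eta T psi,
      natural_parameter_space Theta h eta T psi !=set0
    & open (natural_parameter_space Theta h eta T psi)].

End Models.

(* R^d with d = \sum_i (kappa_i - 1), as row vectors made of one block of
   length kappa_i - 1 per inner vertex. *)
Definition block_vector (R : realType) (T : tree)
    (a : forall i : 'I_(n_inner T), 'I_(kappa i).-1 -> R) :
    'rV[R]_(\sum_(i < n_inner T) (kappa i).-1) :=
  \mxrow_(i < n_inner T) (\row_(j < (kappa i).-1) a i j).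

(* Main.v *)
Require Import Defs.
From HB Require Import structures.
From mathcomp Require Import all_boot all_order all_algebra.
From mathcomp Require Import all_classical all_reals all_analysis.
From mathcomp Require Import ring lra.

Import Order.TTheory GRing.Theory Num.Theory.
Import numFieldNormedType.Exports.

Local Open Scope classical_set_scope.
Local Open Scope ring_scope.

(** Write N_v for the product of the labels on the downward path from a vertex v
to a leaf, and call o_e = theta_e N_w / N_v the odds of an edge e from v to w:
the probability, starting at v, of taking e and then only downward edges,
relative to that of taking downward edges alone.  A downward edge has odds 1.

Density.  Along a root-to-leaf path the factors N_w / N_v telescope to
1 / N_root, so the product of the labels of the path is N_root times the product
of its odds ([path_prob_odds]).  Since downward edges contribute 1, only the
indicators of the other edges remain; taking logarithms gives the exponential
form with eta = ln odds and psi = - ln N_root.  A path visits an edge at most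
once because depth increases along a walk ([walk_to_uniq_edges]), so that
exponents alpha in {0, 1} do describe the product along the path.

Total mass.  Let W v be the product of the labels from the root to v.  Every
vertex other than the root ends exactly one edge, and the labels out of an inner
vertex sum to 1; hence the sum of W over all vertices is 1 plus the sum of W
over the inner vertices, and what is left for the leaves is 1
([sum_path_prob]).

Natural parameter space.  Any positive numbers a_ij are the odds of some theta
([odds_onto]).  Weight the non-downward edges by a_ij and the downward edges by
1, and let Z v be the sum, over all walks from v to a leaf, of the products of
the weights.  Then theta_ij = w_ij Z_ij / Z_i is a probability labelling, its
N_v is 1 / Z v, and its odds are the weights.  So eta maps onto R^d.

Sufficiency is the easy half of the Fisher-Neyman criterion
([factorization_sufficient]).  For minimality ([full_minimal_sufficient]), let
S' be sufficient and S' x = S' y.  Then p_t x / p_t y does not depend on t, that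
is, dot (eta t) (S x - S y) is constant in t; as eta attains both 0 and
S x - S y, the squared norm of S x - S y vanishes. *)

(** * Exponential families on a finite space *)

Section ExponentialFamilies.
Context {R : realType} {X : finType} {P : Type}.
Implicit Types (Theta : set P) (p : P -> X -> R).

(** Given S = y, the factor g t y of the density cancels and leaves a conditional
law proportional to h. *)
Lemma factorization_sufficient Theta p (Y : eqType) (S : X -> Y)
    (h : X -> R) (g : P -> Y -> R) :
  (forall t, Theta t -> forall x, p t x = h x * g t (S x)) ->
  sufficient Theta p S.
Proof.
move=> pE.
have condE t x y : Theta t -> 0 < stat_prob (p t) S y ->
    cond_prob (p t) S x y = (if S x == y then h x else 0) / stat_prob h S y.
  move=> Tt; rewrite /cond_prob.
  have -> : stat_prob (p t) S y = stat_prob h S y * g t y.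
    rewrite /stat_prob mulr_suml; apply: eq_bigr => z /eqP <-.
    exact: pE.
  have -> : (if S x == y then p t x else 0)
            = (if S x == y then h x else 0) * g t y.
    by case: eqP => [<-|_]; rewrite ?mul0r // pE.
  move=> /lt0r_neq0; rewrite mulf_eq0 negb_or => /andP[_ g_neq0].
  by rewrite -mulf_div divff // mulr1.
by move=> t t' Tt Tt' y pt pt' x; rewrite !condE.
Qed.

(** On a fibre of a sufficient statistic the likelihood ratio between two points
is the ratio of conditional probabilities, hence the same for all parameters;
it is cross-multiplied here to avoid division. *)
Lemma sufficient_ratio Theta p (Z : eqType) (S : X -> Z) t t' x y :
  sufficient Theta p S -> Theta t -> Theta t' ->
  (forall z, 0 < p t z) -> (forall z, 0 < p t' z) -> S x = S y ->
  p t x * p t' y = p t' x * p t y.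
Proof.
move=> suffS Tt Tt' pt pt' Sxy.
have stat_gt0 q : (forall z, 0 < q z) -> 0 < stat_prob q S (S x) :> R.
  move=> q_gt0; rewrite /stat_prob (bigD1 x) //= ltr_pwDl // sumr_ge0 // => z _.
  exact: ltW.
have H := suffS _ _ Tt Tt' _ (stat_gt0 _ pt) (stat_gt0 _ pt').
have := H x; have := H y; rewrite /cond_prob -Sxy !eqxx.
set a := stat_prob (p t) _ _; set b := stat_prob (p t') _ _.
have a_neq0 : a != 0 by exact/lt0r_neq0/stat_gt0.
have b_neq0 : b != 0 by exact/lt0r_neq0/stat_gt0.
move=> /eqP; rewrite eqr_div // => /eqP Hy /eqP; rewrite eqr_div // => /eqP Hx.
apply: (mulfI a_neq0); apply: (mulfI b_neq0).
transitivity ((p t x * b) * (p t' y * a)); first by ring.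
by rewrite Hx -Hy; ring.
Qed.

Lemma dotBr d (u v v' : 'rV[R]_d) : dot u (v - v') = dot u v - dot u v'.
Proof. by rewrite /dot linearB /= mulmxBr !mxE. Qed.

Lemma dot0l d (v : 'rV[R]_d) : dot 0 v = 0.
Proof. by rewrite /dot mul0mx mxE. Qed.

Lemma dot_self_eq0 d (u : 'rV[R]_d) : dot u u = 0 -> u = 0.
Proof.
move=> u0; have sq0 : \sum_i u 0 i ^+ 2 = 0.
  rewrite -[RHS]u0 /dot mxE; apply: eq_bigr => i _.
  by rewrite mxE expr2.
apply/rowP => i; rewrite mxE; apply/eqP; rewrite -sqrf_eq0; apply/eqP.
exact: (psumr_eq0P (fun j _ => sqr_ge0 (u 0 j)) sq0).
Qed.

(** On a fibre of another sufficient statistic, dot (eta t) (S x - S y) does not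
depend on t; as [eta] is onto it may be compared at the natural parameters 0 and
S x - S y, which forces S x = S y. *)
Lemma full_minimal_sufficient Theta p d (h : X -> R) (eta : P -> 'rV[R]_d)
    (S : X -> 'rV[R]_d) (psi : P -> R) :
  (forall x, 0 < h x) ->
  (forall t, Theta t -> forall x, p t x = exp_density h eta S psi t x) ->
  (forall u, exists2 t, Theta t & eta t = u) ->
  minimal_sufficient Theta p S.
Proof.
move=> h_gt0 pE eta_onto; split.
  apply: (@factorization_sufficient _ _ _ _ h
            (fun t y => expR (dot (eta t) y - psi t))) => t Tt x.
  by rewrite pE.
have p_gt0 t : Theta t -> forall x, 0 < p t x.
  by move=> Tt x; rewrite pE // mulr_gt0 ?expR_gt0.
move=> Z S' suffS'.
have fiber x y : S' x = S' y -> S x = S y.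
  move=> S'xy.
  have [t0 Tt0 eta0] := eta_onto 0.
  have [t Tt etat] := eta_onto (S x - S y).
  have := sufficient_ratio _ _ _ _ _ _ _ _ suffS' Tt Tt0
            (p_gt0 _ Tt) (p_gt0 _ Tt0) S'xy.
  rewrite !pE // /exp_density eta0 etat !dot0l !sub0r.
  rewrite mulrACA [RHS]mulrACA -!expRD => /mulfI.
  rewrite mulf_neq0 ?gt_eqF // => /(_ isT)/expR_inj.
  move=> H; apply/eqP; rewrite -subr_eq0; apply/eqP/dot_self_eq0.
  rewrite dotBr; lra.
(* 0 is a default value outside the image of S' *)
exists (fun z => if [pick x | S' x == z] is Some x then S x else 0).
move=> t _ x _; case: pickP => [y /eqP/fiber //|/(_ x)].
by rewrite eqxx.
Qed.

(** Sums over a finite space are always summable. *)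
Lemma finite_natural_parameter_space Theta d (h : X -> R) (eta : P -> 'rV[R]_d)
    (S : X -> 'rV[R]_d) (psi : P -> R) :
  natural_parameter_space Theta h eta S psi = eta @` Theta.
Proof.
rewrite /natural_parameter_space; congr image.
apply/seteqP; split => t /= => [[]//|Tt]; split => //.
rewrite /summable esum_fset //; last exact: finite_finset.
rewrite fsbig_finite; last exact: finite_finset.
by under eq_bigr do rewrite abse_EFin; rewrite sumEFin ltry.
Qed.

End ExponentialFamilies.

(** * Walks in the tree *)

(** The parametrizations of leaves by paths, of non-root vertices by edges and of
inner vertices by indices are all injections onto a decidable subset. *)
Lemma big_inj_image {A : Type} {idx : A} {op : Monoid.com_law idx}
    {I J : finType} (h : J -> I) (P : pred I) (F : I -> A) :
  injective h -> (forall i, reflect (exists j, h j = i) (P i)) ->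
  \big[op/idx]_(i | P i) F i = \big[op/idx]_j F (h j).
Proof.
move=> h_inj hP.
rewrite (reindex_omap h (fun i => [pick j | h j == i])).
  apply: eq_bigl => j; have -> : P (h j) by apply/hP; exists j.
  by case: pickP => [j' /eqP/h_inj ->|/(_ j)]; rewrite eqxx.
by move=> i /hP[j <-]; case: pickP => [j' /eqP/= -> //|/(_ j)]; rewrite eqxx.
Qed.

Section Tree.
Context {T : tree}.
Implicit Types (v w : vertex T) (e : edge T) (i : 'I_(n_inner T)).

Lemma is_walk_rcons (G : out_graph) (v w : vertex G) (s : seq (edge G))
    (e : edge G) :
  is_walk v (rcons s e) w = is_walk v s (src e) && (tgt e == w).
Proof.
elim: s v => [|f s IH] v /=; first by rewrite [v == _]eq_sym.
by rewrite IH andbA.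
Qed.

Lemma is_walk_end (G : out_graph) (u v w : vertex G) (s : seq (edge G)) :
  is_walk u s v -> is_walk u s w -> v = w.
Proof.
elim: s u => [|e s IH] u /=; first by move=> /eqP <- /eqP.
by move=> /andP[_ /IH H] /andP[_ /H].
Qed.

Lemma walk_to_root : walk_to (root_vertex T) = [::].
Proof. by apply: walk_to_uniq => /=. Qed.

Lemma walk_to_tgt e : walk_to (tgt e) = rcons (walk_to (src e)) e.
Proof. exact/walk_to_uniq/walk_rcons/walk_toP. Qed.

(** A vertex has one incoming edge: the last edge of its only walk from the root. *)
Lemma tgt_inj : injective (@tgt T).
Proof.
move=> e f ef; have := walk_to_tgt e.
by rewrite ef walk_to_tgt => /rcons_inj [].
Qed.

Lemma tgt_neq_root e : tgt e != root_vertex T.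
Proof.
apply/eqP => H; have := walk_to_tgt e; rewrite H walk_to_root.
by case: (walk_to _).
Qed.

Lemma neq_rootP v : reflect (exists e, tgt e = v) (v != root_vertex T).
Proof.
apply: (iffP idP) => [|[e <-]]; last exact: tgt_neq_root.
move: (walk_toP v); case/lastP: (walk_to v) => [/eqP <-|s e].
  by rewrite eqxx.
by rewrite is_walk_rcons => /andP[_ /eqP <-]; exists e.
Qed.

(** Induction from the root towards the leaves; [subtree_ind] goes the other way. *)
Lemma walk_to_ind (Q : vertex T -> Prop) :
  Q (root_vertex T) -> (forall e, Q (src e) -> Q (tgt e)) -> forall v, Q v.
Proof.
move=> Q0 QS v; move: (walk_to v) (walk_toP v) => s.
elim/last_ind: s v => [|s e IH] v.
  by move=> /eqP <-.
by rewrite is_walk_rcons => /andP[/IH Qs /eqP <-]; exact: QS.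
Qed.

Lemma walk_to_uniq_edges v : uniq (walk_to v).
Proof.
(* An edge e extending the walk ends deeper than every edge already on it, hence
   is new; the induction has to carry the bound on depths. *)
suff /andP[] : uniq (walk_to v) &&
  all (fun f => size (walk_to (tgt f)) <= size (walk_to v))%N (walk_to v) by [].
elim/walk_to_ind: v => [|e /andP[Hu /allP Ha]]; first by rewrite walk_to_root.
rewrite walk_to_tgt rcons_uniq Hu andbT all_rcons walk_to_tgt leqnn /=.
apply/andP; split.
  by apply/negP => /Ha; rewrite walk_to_tgt size_rcons ltnn.
by apply/allP => f /Ha fs; rewrite size_rcons ltnW.
Qed.

Lemma path_walk_to (x : path_of T) : path_edges x = walk_to (path_leaf x).
Proof.
by rewrite /path_leaf; have /andP[_ /walk_to_uniq ->] := xchooseP (existsP (path_ofP x)).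
Qed.

Lemma path_leaf_is_leaf (x : path_of T) : is_leaf (path_leaf x).
Proof. by have /andP[] := xchooseP (existsP (path_ofP x)). Qed.

Lemma is_leafP v : reflect (exists x, path_leaf x = v) (is_leaf v).
Proof.
apply: (iffP idP) => [lv|[x <-]]; last exact: path_leaf_is_leaf.
have rl : is_root_leaf (walk_to v).
  by apply/existsP; exists v; rewrite lv walk_toP.
exists (PathOf rl); apply: (is_walk_end _ (root_vertex T) _ _ (walk_to v)).
  by have := walk_toP (path_leaf (PathOf rl)); rewrite -path_walk_to.
exact: walk_toP.
Qed.

Lemma is_leafPn v : reflect (exists i, inner i = v) (~~ is_leaf v).
Proof.
rewrite /is_leaf negb_forall; apply: (iffP existsP) => -[i].
  by rewrite negbK => /eqP <-; exists i.
by move=> <-; exists i; rewrite eqxx.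
Qed.

Lemma subtree_ind (Q : vertex T -> Prop) :
  (forall v, is_leaf v -> Q v) ->
  (forall i, (forall j, Q (child i j)) -> Q (inner i)) -> forall v, Q v.
Proof.
move=> Qleaf Qinner v.
have [n] := ubnP (tree_height T - size (walk_to v)); elim: n v => // n IH v Hn.
have [/Qleaf //|/is_leafPn[i iv]] := boolP (is_leaf v); subst v.
apply: Qinner => j; apply: IH; rewrite size_walk_child.
have := size_walk_tree_height (child i j); rewrite size_walk_child => Hh.
by rewrite ltnS in Hn; apply: leq_trans Hn; rewrite ltn_sub2l.
Qed.

(** Functions on the vertices defined by recursion from the leaves: iterating the
recursion step as many times as the tree is high reaches a fixed point. *)
Lemma tree_rec_exists {A : Type} (a : A) (F : forall i, ('I_(kappa i) -> A) -> A) :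
  exists f : vertex T -> A,
    (forall v, is_leaf v -> f v = a) /\
    forall i, f (inner i) = F i (fun j => f (child i j)).
Proof.
pose step (f : vertex T -> A) v :=
  if [pick i | inner i == v] is Some i then F i (fun j => f (child i j)) else a.
have step_inner f i : step f (inner i) = F i (fun j => f (child i j)).
  rewrite /step; case: pickP => [i' /eqP /inner_inj -> //|/(_ i)].
  by rewrite eqxx.
have step_leaf f v : is_leaf v -> step f v = a.
  by move=> /forallP lv; rewrite /step; case: pickP => // i /(negP (lv i)).
pose f n := iter n step (fun=> a).
have stable v : forall n, (tree_height T <= size (walk_to v) + n)%N ->
    f n.+1 v = f n v.
  elim/subtree_ind: v => [v lv|i IH].
    by case=> [|n] _; rewrite /f !iterS !step_leaf.
  case=> [|n] Hn.
    have := size_walk_tree_height (child i (last_edge i)).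
    by rewrite addn0 in Hn; rewrite size_walk_child ltnNge Hn.
  rewrite /f 2!iterS !step_inner; congr F; apply/funext => j.
  by apply: IH; rewrite size_walk_child addSnnS.
exists (f (tree_height T)).
have fix_f v : f (tree_height T) v = step (f (tree_height T)) v.
  by rewrite -(stable v _ (leq_addl _ _)).
by split=> [v lv|i]; rewrite fix_f; [exact: step_leaf|exact: step_inner].
Qed.

(** A path never repeats an edge, so exponents in {0, 1} count every factor of the
product along the path. *)
Lemma prod_alpha {R : realType} (F : forall i, 'I_(kappa i) -> R) (x : path_of T) :
  \prod_(i < n_inner T) \prod_(j < kappa i) F i j ^+ alpha j x
  = \prod_(e <- path_edges x) F (tag e) (tagged e).
Proof.
rewrite [RHS]big_uniq; last by rewrite path_walk_to walk_to_uniq_edges.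
rewrite sig_big_dep /= [RHS]big_mkcond /=; apply: eq_bigr => -[i j] _.
by rewrite /alpha /=; case: (_ \in _); rewrite ?expr1 ?expr0.
Qed.

Lemma telescope_walk {F : fieldType} (g : vertex T -> F) v w s :
  (forall u, g u != 0) -> is_walk v s w ->
  \prod_(e <- s) (g (tgt e) / g (src e)) = g w / g v.
Proof.
move=> g0; elim: s v => [|e s IH] v /=; first by move=> /eqP ->; rewrite big_nil divff.
case/andP=> /eqP <- /IH; rewrite big_cons => ->.
by rewrite mulrC mulf_div [g w * _]mulrC -mulf_div divff ?mul1r.
Qed.

End Tree.

(** * Probabilities and odds *)

Section Model.
Context {R : realType} {T : tree}.
Implicit Types (theta : param R T) (i : 'I_(n_inner T)) (x : path_of T).

Lemma big_upper_last {A : Type} {idx : A} (op : Monoid.law idx) i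
    (F : 'I_(kappa i) -> A) :
  \big[op/idx]_(j < kappa i) F j
  = op (\big[op/idx]_(s < (kappa i).-1) F (upper_edge s)) (F (last_edge i)).
Proof.
rewrite /upper_edge /last_edge.
move: (kappa_pred_lt i) (leq_pred (kappa i)) F; case: (kappa i) => // n lt le F.
rewrite big_ord_recr /=; congr (op _ (F _)); last exact: val_inj.
by apply: eq_bigr => s _; congr F; exact: val_inj.
Qed.

Lemma theta_gt0 theta : param_space R T theta -> forall i j, 0 < theta i 0 j.
Proof. by move=> Th i j; have [_ /(_ j)/andP[]] := Th i. Qed.

Lemma theta_last theta : param_space R T theta -> forall i,
  theta i 0 (last_edge i) = 1 - \sum_(s < (kappa i).-1) theta i 0 (upper_edge s).
Proof.
move=> Th i; have [<- _] := Th i.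
by rewrite big_upper_last /= addrAC subrr add0r.
Qed.

Lemma downN_innerE theta : param_space R T theta -> forall i,
  downN theta (inner i)
  = theta i 0 (last_edge i) * downN theta (child i (last_edge i)).
Proof. by move=> Th i; rewrite theta_last // downN_inner. Qed.

Lemma downN_gt0 theta : param_space R T theta -> forall v, 0 < downN theta v.
Proof.
move=> Th v; elim/(@subtree_ind T): v => [v /downN_leaf -> //|i IH].
by rewrite downN_innerE // mulr_gt0 // theta_gt0.
Qed.

Definition walk_prob theta (s : seq (edge T)) : R :=
  \prod_(e <- s) theta (tag e) 0 (tagged e).

Lemma path_probE theta x : path_prob theta x = walk_prob theta (path_edges x).
Proof. exact: (prod_alpha (fun i j => theta i 0 j)). Qed.

(** The sum of the walk probabilities W over all vertices is computed twice: by
splitting leaves from inner vertices, and by charging each non-root vertex to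
its incoming edge. *)
Lemma sum_path_prob theta : param_space R T theta ->
  \sum_x path_prob theta x = 1.
Proof.
move=> Th; pose W v := walk_prob theta (walk_to v).
have -> : \sum_x path_prob theta x = \sum_(v | is_leaf v) W v.
  rewrite (big_inj_image _ _ _ (pcan_inj (@path_leafK T)) (@is_leafP T)).
  by apply: eq_bigr => x _; rewrite path_probE path_walk_to.
have total : \sum_v W v = 1 + \sum_i W (inner i).
  rewrite (bigD1 (root_vertex T)) //=; congr (_ + _).
    by rewrite /W walk_to_root /walk_prob big_nil.
  rewrite (big_inj_image _ _ _ (@tgt_inj T) (@neq_rootP T)).
  transitivity (\sum_(e : edge T) W (src e) * theta (tag e) 0 (tagged e)).
    apply: eq_bigr => e _; rewrite /W walk_to_tgt /walk_prob.
    by rewrite -cats1 big_cat big_seq1.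
  rewrite -(sig_big_dep xpredT (fun _ => xpredT)
              (fun i j => W (inner i) * theta i 0 j)) /=.
  by apply: eq_bigr => i _; rewrite -mulr_sumr; have [-> _] := Th i; rewrite mulr1.
move: total; rewrite (bigID (@is_leaf T)) /=.
rewrite (big_inj_image _ _ _ (@inner_inj T) (@is_leafPn T)).
by move/addIr.
Qed.

(** The exponential of the natural parameter when j is not the last edge: the
probability of taking the edge j and then only downward edges, divided by that of
taking only downward edges from the start. *)
Definition odds theta i (j : 'I_(kappa i)) : R :=
  theta i 0 j * downN theta (child i j) / downN theta (inner i).

Lemma odds_gt0 theta : param_space R T theta -> forall i j, 0 < odds theta i j.
Proof.
by move=> Th i j; rewrite /odds divr_gt0 ?mulr_gt0 ?theta_gt0 ?downN_gt0.
Qed.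

Lemma odds_last theta : param_space R T theta -> forall i,
  odds theta i (last_edge i) = 1.
Proof.
move=> Th i; rewrite /odds -downN_innerE // divff //.
exact/lt0r_neq0/downN_gt0.
Qed.

(** Relative to the path that only follows downward edges, which has probability
[downN theta (root_vertex T)], each other edge contributes its odds. *)
Lemma path_prob_odds theta x : param_space R T theta ->
  path_prob theta x = downN theta (root_vertex T) *
    \prod_(i < n_inner T) \prod_(j < (kappa i).-1)
      odds theta i (upper_edge j) ^+ alpha (upper_edge j) x.
Proof.
move=> Th; have N0 v : downN theta v != 0 by exact/lt0r_neq0/downN_gt0.
have -> : \prod_(i < n_inner T) \prod_(j < (kappa i).-1)
      odds theta i (upper_edge j) ^+ alpha (upper_edge j) x
    = \prod_(i < n_inner T) \prod_(j < kappa i) odds theta i j ^+ alpha j x.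
  apply: eq_bigr => i _.
  by rewrite [RHS]big_upper_last /= odds_last // expr1n mulr1.
rewrite prod_alpha path_probE /odds.
under eq_bigr do rewrite -mulrA.
rewrite big_split /=.
rewrite (telescope_walk (downN theta) (root_vertex T) (path_leaf x)) //.
  rewrite (downN_leaf theta (path_leaf_is_leaf x)) mul1r mulrC mulfVK //.
by rewrite path_walk_to walk_toP.
Qed.

Lemma path_prob_exp theta x : param_space R T theta ->
  path_prob theta x =
    expR (\sum_(i < n_inner T) \sum_(j < (kappa i).-1)
            ln (odds theta i (upper_edge j)) * (alpha (upper_edge j) x)%:R
          - - ln (downN theta (root_vertex T))).
Proof.
move=> Th; rewrite path_prob_odds // opprK expRD lnK ?posrE ?downN_gt0 // mulrC.
congr (_ * _); rewrite expR_sum; apply: eq_bigr => i _.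
rewrite expR_sum; apply: eq_bigr => j _.
by rewrite [ln _ * _]mulrC expRM_natl lnK // posrE odds_gt0.
Qed.

Lemma lt1_of_sum1 n (t : 'rV[R]_n) : (1 < n)%N ->
  \sum_r t 0 r = 1 -> (forall r, 0 < t 0 r) -> forall r, t 0 r < 1.
Proof.
move=> n_gt1 t1 t_gt0 r.
have [s sr] : exists s : 'I_n, s != r.
  case: n n_gt1 t t1 t_gt0 r => [|[|n]] // _ _ _ _ r.
  have [->|r0] := eqVneq r ord0; first by exists ord_max.
  by exists ord0; rewrite eq_sym.
rewrite -t1 (bigD1 r) //= (bigD1 s) //= ltrDl ltr_pwDl // sumr_ge0 // => q _.
exact: ltW.
Qed.

(** The natural parameter can be inverted explicitly: theta is the Gibbs
distribution of the edge weights, normalized by the partition functions Z of the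
subtrees. *)
Lemma odds_onto (a : forall i, 'I_(kappa i).-1 -> R) :
  (forall i j, 0 < a i j) ->
  exists2 theta, param_space R T theta &
    forall i j, odds theta i (upper_edge j) = a i j.
Proof.
move=> a_gt0.
(* insub fails exactly on the last edge, which gets weight 1 *)
pose w i (j : 'I_(kappa i)) : R := oapp (a i) 1 (insub (val j)).
have w_gt0 i j : 0 < w i j by rewrite /w; case: insub => /=.
have w_upper i j : w i (upper_edge j) = a i j by rewrite /w /= valK.
have w_last i : w i (last_edge i) = 1 by rewrite /w insubF //= ltnn.
have [Z [Zleaf Zinner]] :=
  tree_rec_exists (1 : R) (fun i z => \sum_j w i j * z j).
have Z_gt0 v : 0 < Z v.
  elim/(@subtree_ind T): v => [v /Zleaf ->//|i IH]; rewrite Zinner.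
  rewrite (bigD1 (last_edge i)) //= ltr_pwDl ?mulr_gt0 // sumr_ge0 // => j _.
  by rewrite ltW // mulr_gt0.
have Z_neq0 v : Z v != 0 by exact: lt0r_neq0.
pose theta : param R T := fun i => \row_j (w i j * Z (child i j) / Z (inner i)).
have Th : param_space R T theta.
  move=> i; have sum1 : \sum_r theta i 0 r = 1.
    under eq_bigr do rewrite mxE.
    by rewrite -mulr_suml -Zinner divff.
  have pos r : 0 < theta i 0 r by rewrite mxE divr_gt0 ?mulr_gt0.
  by split=> // r; rewrite pos (lt1_of_sum1 _ _ (kappa_gt1 i)).
(* N and 1 / Z obey the same recursion since theta_last * Z_i = Z_last *)
have NZ v : downN theta v = (Z v)^-1.
  elim/(@subtree_ind T): v => [v lv|i IH]; first by rewrite downN_leaf // Zleaf // invr1.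
  by rewrite downN_innerE // IH mxE w_last mul1r mulrAC divff // mul1r.
exists theta => // i j; rewrite /odds !NZ mxE w_upper invrK.
by rewrite mulrAC divfK // mulfK.
Qed.

Lemma dot_block_vector (a b : forall i, 'I_(kappa i).-1 -> R) :
  dot (block_vector a) (block_vector b)
  = \sum_(i < n_inner T) \sum_(j < (kappa i).-1) a i j * b i j.
Proof.
rewrite /dot /block_vector tr_mxrow mul_mxrow_mxcol summxE.
apply: eq_bigr => i _; rewrite mxE; apply: eq_bigr => j _.
by rewrite !mxE.
Qed.

Lemma block_vector_onto u : exists a : forall i : 'I_(n_inner T), 'I_(kappa i).-1 -> R,
  block_vector a = u.
Proof.
exists (fun i j => submxrow u i 0 j); rewrite -[RHS]submxrowK.
by apply: eq_mxrow => i; apply/rowP => j; rewrite mxE.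
Qed.

End Model.

(** * The exponential family of a probability tree *)

Theorem proposition1 (R : realType) (T : tree) :
  let Theta : set (param R T) := param_space R T in
  let p : param R T -> path_of T -> R := @path_prob R T in
  let h : path_of T -> R := fun=> 1 in
  let suff (i : 'I_(n_inner T)) (j : 'I_(kappa i).-1) (x : path_of T) : R :=
    (alpha (upper_edge j) x)%:R in
  let eta (i : 'I_(n_inner T)) (j : 'I_(kappa i).-1) (theta : param R T) : R :=
    ln (theta i 0 (upper_edge j) * downN theta (child i (upper_edge j))
        / downN theta (inner i)) in
  let psi (theta : param R T) : R := - ln (downN theta (root_vertex T)) in
  let sufficient_stat (x : path_of T) : 'rV[R]_(\sum_(i < n_inner T) (kappa i).-1) :=
    block_vector (fun i j => suff i j x) in
  let natural_param (theta : param R T) :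
      'rV[R]_(\sum_(i < n_inner T) (kappa i).-1) :=
    block_vector (fun i j => eta i j theta) in
  [/\ regular_exponential_family Theta p h natural_param sufficient_stat psi,
      forall theta, Theta theta -> forall x : path_of T,
        p theta x =
        h x * expR (\sum_(i < n_inner T) \sum_(j < (kappa i).-1)
                      eta i j theta * suff i j x - psi theta),
      sufficient Theta p sufficient_stat
    & natural_parameter_space Theta h natural_param sufficient_stat psi
      = [set: 'rV[R]_(\sum_(i < n_inner T) (kappa i).-1)] ].
Proof.
move=> Theta p h suff eta psi S natural_param.
have density theta : Theta theta -> forall x, p theta x =
    h x * expR (\sum_(i < n_inner T) \sum_(j < (kappa i).-1)
                  eta i j theta * suff i j x - psi theta).
  by move=> Th x; rewrite mul1r; exact: path_prob_exp.
have exp_form theta : Theta theta -> forall x, p theta x =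
    exp_density h natural_param S psi theta x.
  by move=> Th x; rewrite density // /exp_density dot_block_vector.
have eta_onto u : exists2 theta, Theta theta & natural_param theta = u.
  have [a <-] := block_vector_onto u.
  have [theta Th oddsE] := odds_onto (fun i j => expR (a i j))
                             (fun i j => expR_gt0 _).
  exists theta => //; apply: eq_mxrow => i; apply/rowP => j; rewrite !mxE.
  by rewrite -[RHS]expRK; congr ln; exact: oddsE.
have min_suff : minimal_sufficient Theta p S.
  by apply: full_minimal_sufficient exp_form eta_onto => x; exact: ltr01.
have space : natural_parameter_space Theta h natural_param S psi = setT.
  rewrite finite_natural_parameter_space.
  by apply/seteqP; split=> // u _; have [theta Th <-] := eta_onto u; exists theta.
split=> //; last by case: min_suff.
split; [split=> // theta Th; split|rewrite space; by exists 0|rewrite space; exact: openT].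
  by move=> x; rewrite exp_form // /exp_density /h mul1r expR_ge0.
exact: sum_path_prob.
Qed.
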